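(* Let $Y$ be a real topological vector space, $F\subseteq Y$, $a\in Y$, let $H$ be a proper closed subset of $Y$ and $k\in 0^+H\setminus\{0\}$. Assume that there exists $t_1\in\mathbb{R}$ such that $F\cap(a-H+t_1k)$ is nonempty and compact. (a) If there exists $t\in\mathbb{R}$ with $F\cap(a-H+tk)=\emptyset$, then $M_{F,a,H,k}$ is nonempty and compact. (b) There exists $t\in\mathbb{R}$ with $F\cap(a-H+tk)=\emptyset$ if and only if $\varphi_{a-H,k}$ is finite-valued on $F\cap\operatorname{dom}\varphi_{a-H,k}$.
   Context: For $A\subseteq Y$, the recession cone is $0^+A:=\{u\in Y\mid A+\mathbb{R}_+u\subseteq A\}$, where $\mathbb{R}_+=[0,\infty)$. A proper subset of $Y$ is a nonempty subset different from $Y$. The functional $\varphi_{a-H,k}:Y\to\mathbb{R}\cup\{-\infty,+\infty\}$ is $\varphi_{a-H,k}(y):=\inf\{t\in\mathbb{R}\mid y\in a-H+tk\}$ with $\inf\emptyset=+\infty$; $\operatorname{dom}\varphi_{a-H,k}:=\{y\in Y\mid\varphi_{a-H,k}(y)<+\infty\}$ (the value $-\infty$ is allowed). Finite-valued on a set means attaining only real values on that set. $(P_{F,a,H,k})$ is the problem of minimizing $t$ over all pairs $(y,t)\in F\times\mathbb{R}$ with $y\in a-H+tk$ (the feasible solutions). $M_{F,a,H,k}$ is the set of its optimal solutions $y$, i.e. of all $y\in F$ for which there is $t\in\mathbb{R}$ such that $(y,t)$ is feasible and $t\le s$ for every feasible $(z,s)$. *)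

(* Defs.v *)
From HB Require Import structures.
From mathcomp Require Import all_boot all_order all_algebra.
From mathcomp Require Import all_classical all_reals all_analysis.

Set Implicit Arguments.
Unset Strict Implicit.
Unset Printing Implicit Defensive.

Import Order.TTheory GRing.Theory Num.Theory.

Local Open Scope classical_set_scope.
Local Open Scope ring_scope.

(* [topologicalLmodType R] is used rather than [tvsType R]: the latter also
   requires local convexity.  No separation axiom is assumed. *)

Definition recession_cone (R : realType) (Y : lmodType R) (A : set Y) : set Y :=
  [set u | [set x + s *: u | x in A & s in [set s : R | 0 <= s]] `<=` A].

Definition proper_subset (Y : Type) (A : set Y) : Prop :=
  A !=set0 /\ A <> setT.

Definition reflect_at (R : realType) (Y : lmodType R) (a : Y) (H : set Y) :
  set Y := [set a - h | h in H].

Definition shift_along (R : realType) (Y : lmodType R) (A : set Y) (k : Y)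
  (t : R) : set Y := [set x + t *: k | x in A].

(* [ereal_inf set0 = +oo]; the value [-oo] is possible. *)
Definition phi (R : realType) (Y : lmodType R) (A : set Y) (k : Y) (y : Y) :
  \bar R := ereal_inf [set t%:E | t in [set t : R | shift_along A k t y]].

Definition dom (R : realType) (Y : Type) (f : Y -> \bar R) : set Y :=
  [set y | (f y < +oo)%E].

Definition finite_valued_on (R : realType) (Y : Type) (f : Y -> \bar R)
  (D : set Y) : Prop := forall y, D y -> f y \is a fin_num.

Definition feasible (R : realType) (Y : lmodType R) (F : set Y) (a : Y)
  (H : set Y) (k : Y) : set (Y * R) :=
  [set yt | F yt.1 /\ shift_along (reflect_at a H) k yt.2 yt.1].

Definition optimal_solutions (R : realType) (Y : lmodType R) (F : set Y)
  (a : Y) (H : set Y) (k : Y) : set Y :=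
  [set y | F y /\ exists t : R, feasible F a H k (y, t) /\
     forall z s, feasible F a H k (z, s) -> t <= s].

(* Main.v *)
(* Write S t for a - H + t k.  A point y lies in S t iff a + t k - y lies in H,
   so t |-> S t is nondecreasing (k is a recession direction), every S t is
   closed, and S m is the intersection of the S t with t > m.  By compactness
   of a slice F n S t1, F meets the intersection of any nonempty family of
   slices each of which meets F.  If some F n S t is empty, apply this to the
   t > m, where m is the infimum of the t for which F n S t is nonempty: then
   F n S m is nonempty, and it is the solution set.  If no F n S t is empty,
   apply it to all t: a common point has phi equal to -oo. *)

Require Import Defs.
From HB Require Import structures.
From mathcomp Require Import all_boot all_order all_algebra.
From mathcomp Require Import all_classical all_reals all_analysis.

Set Implicit Arguments.
Unset Strict Implicit.
Unset Printing Implicit Defensive.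

Import Order.TTheory GRing.Theory Num.Theory.

Local Open Scope classical_set_scope.
Local Open Scope ring_scope.

(** The traces [K]&[C t] form a filter base, since by monotonicity the smaller of two indices serves
    both. A cluster point in [K] of the resulting filter adheres to each closed [C t], hence lies in
    it. *)
Lemma compact_nested_nonempty (R : realType) (T : topologicalType) (K : set T)
    (D : set R) (C : R -> set T) :
  compact K -> D !=set0 -> {homo C : s t / s <= t >-> s `<=` t} ->
  (forall t, D t -> closed (C t)) -> (forall t, D t -> K `&` C t !=set0) ->
  K `&` \bigcap_(t in D) C t !=set0.
Proof.
move=> K_compact D0 C_mono C_closed KC0.
pose B := filter_from D (fun t => K `&` C t).
have B_filter : Filter B.
  apply: filter_from_filter => // s t Ds Dt.
  exists (Num.min s t); first by rewrite minEle; case: ifP.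
  move=> x [Kx Cx]; split; split=> //; apply: C_mono Cx.
  - by rewrite ge_min lexx.
  - by rewrite ge_min lexx orbT.
have B_proper : ProperFilter B by apply: filter_from_proper.
have [t0 Dt0] := D0.
have BK : B K by exists t0 => // x [].
have [y [Ky y_cluster]] := K_compact B B_proper BK.
exists y; split=> // t Dt; apply: C_closed => // U Uy.
by apply: y_cluster => //; exists t => // x [].
Qed.

Lemma closed_right_endpoint (R : realType) (C : set R^o) (m : R) :
  closed C -> (forall t, m < t -> C t) -> C m.
Proof.
move=> C_closed C_gt; apply: C_closed => U /nbhs_ballP[e /= e0 eU].
(* The point [m + e / 2] lies to the right of [m] and inside the ball of radius [e]. *)
have e20 : 0 < e / 2 by rewrite divr_gt0.
exists (m + e / 2); split; first by apply: C_gt; rewrite ltrDl.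
apply: eU; rewrite /ball /= opprD addrA subrr sub0r normrN gtr0_norm //.
by rewrite ltr_pdivrMr // ltr_pMr // ltr1n.
Qed.

Section Slices.
Variables (R : realType) (Y : topologicalLmodType R).
Variables (F : set Y) (a : Y) (H : set Y) (k : Y).
Let S := shift_along (reflect_at a H) k.

Lemma sliceE t y : S t y <-> H (a + t *: k - y).
Proof.
split=> [[_ [h Hh <-] <-]|Hy].
  suff -> : a + t *: k - (a - h + t *: k) = h by [].
  by rewrite [a - h + _]addrAC opprB [LHS]addrC subrK.
exists (y - t *: k); last by rewrite subrK.
by exists (a + t *: k - y) => //; rewrite opprB addrCA opprD addNKr.
Qed.

Lemma slice_mono : recession_cone H k -> {homo S : s t / s <= t >-> s `<=` t}.
Proof.
move=> k_rec s t s_le_t y /sliceE Hy; apply/sliceE; apply: k_rec.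
exists (a + s *: k - y) => //; exists (t - s); first by rewrite /= subr_ge0.
have -> : a + t *: k = a + s *: k + (t - s) *: k
  by rewrite -addrA -scalerDl [s + _]addrC subrK.
exact: addrAC.
Qed.

Lemma slice_closed t : closed H -> closed (S t).
Proof.
move=> H_closed.
have -> : S t = (fun y => a + t *: k - y) @^-1` H.
  by apply/seteqP; split=> y /sliceE.
apply: preimage_closed => // y _.
apply: (@continuous_comp _ _ _ (fun y : Y => (a + t *: k, y))
  (fun z : Y * Y => z.1 - z.2)); last exact: sub_continuous.
by apply: cvg_pair; [exact: cvg_cst|exact: cvg_id].
Qed.

(** Here [y] is fixed and [t] varies: the parameters [t] with [S t y] form the preimage of [H] under
    the continuous map sending [t] to [a + t *: k - y], a closed subset of the line. *)
Lemma slice_right_closed (m : R) y :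
  closed H -> (forall t, m < t -> S t y) -> S m y.
Proof.
move=> H_closed Sy; apply/sliceE.
apply: (@closed_right_endpoint R (fun t => H (a + t *: k - y))) => [|t mt];
  last exact/sliceE/Sy.
apply: (@preimage_closed R^o Y (fun t => a + t *: k - y)) => // t _.
apply: (@continuous_comp R^o _ _ (fun t : R^o => (a + t *: k, y))
  (fun z : Y * Y => z.1 - z.2)); last exact: sub_continuous.
apply: cvg_pair; last exact: cvg_cst.
apply: (@continuous_comp R^o _ _ (fun t : R^o => (a, t *: k))
  (fun z : Y * Y => z.1 + z.2)); last exact: tvs.add_continuous.
apply: cvg_pair; first exact: cvg_cst.
apply: (@continuous_comp R^o _ _ (fun t : R^o => (t, k))
  (fun z : R^o * Y => z.1 *: z.2)); last exact: tvs.scale_continuous.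
by apply: (@cvg_pair _ _ _ _ (nbhs t)); [exact: cvg_id|exact: cvg_cst].
Qed.

Lemma slice_bigcap_nonempty (D : set R) (t1 : R) :
  closed H -> recession_cone H k -> compact (F `&` S t1) ->
  F `&` S t1 !=set0 -> D !=set0 -> (forall t, D t -> F `&` S t !=set0) ->
  (F `&` S t1) `&` \bigcap_(t in D) S t !=set0.
Proof.
move=> H_closed k_rec K_compact K0 D0 DS.
apply: compact_nested_nonempty => //; first exact: slice_mono.
  by move=> t _; exact: slice_closed.
(* For [t <= t1], a point of [F] in [S t] is already in [S t1]; for [t >= t1], any point of the
   compact slice is in [S t]. *)
move=> t Dt; have [t_le|/ltW t1_le] := leP t t1.
  by have [y [Fy Sy]] := DS t Dt; exists y; do !split=> //; apply: slice_mono Sy.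
by have [y [Fy Sy]] := K0; exists y; do !split=> //; apply: slice_mono Sy.
Qed.

(** Otherwise monotonicity would put [y] into the empty slice. This bounds from below both the
    attainable parameters and [phi] on [F]. *)
Lemma slice_lower_bound (t0 t : R) y :
  recession_cone H k -> F `&` S t0 = set0 -> F y -> S t y -> t0 <= t.
Proof.
move=> k_rec S0 Fy Sy; rewrite leNgt; apply/negP => /ltW t_le.
suff : (F `&` S t0) y by rewrite S0.
by split=> //; apply: slice_mono Sy.
Qed.

Lemma optimal_solutions_slice (t1 : R) :
  closed H -> recession_cone H k -> F `&` S t1 !=set0 ->
  compact (F `&` S t1) -> (exists t, F `&` S t = set0) ->
  exists m, [/\ m <= t1, F `&` S m !=set0 &
    optimal_solutions F a H k = F `&` S m].
Proof.
move=> H_closed k_rec K0 K_compact [t0 S0].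
pose T := [set t | F `&` S t !=set0].
(* The empty slice at [t0] bounds [T] from below, so [inf T] is a genuine infimum and not a default
   value. *)
have T_lb t : T t -> inf T <= t.
  move=> Tt; apply: ge_inf => //; exists t0 => s [y [Fy Sy]].
  exact: slice_lower_bound Sy.
have T_gt t : inf T < t -> T t.
  case/inf_lt; first by exists t1.
  by move=> s [y [Fy Sy]] /ltW s_le; exists y; split=> //; apply: slice_mono Sy.
have [y [[Fy _] Sy]] : (F `&` S t1) `&` \bigcap_(t in [set t | inf T < t]) S t
    !=set0.
  apply: slice_bigcap_nonempty => //.
  by exists (inf T + 1); rewrite /= ltrDl.
have Sm := slice_right_closed H_closed Sy.
exists (inf T); split; [exact: T_lb|by exists y|].
apply/seteqP; split=> z.
  (* Comparing the optimal value [t] of [z] with the feasible pair [(y, inf T)] gives [t <= inf T],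
     and monotonicity moves [z] into the slice at [inf T]. *)
  move=> [Fz [t [[_ Sz] t_min]]]; split=> //.
  by apply: slice_mono Sz => //; apply: t_min; split; [exact: Fy|exact: Sm].
move=> [Fz Sz]; split=> //; exists (inf T); split=> // w s [Fw Sw].
by apply: T_lb; exists w.
Qed.

Lemma phi_ninfty y :
  (forall t, S t y) -> phi (reflect_at a H) k y = -oo%E.
Proof.
by move=> Sy; apply: eq_ninfty => t; apply: ereal_inf_lbound; exists t => //; exact: Sy.
Qed.

End Slices.

Theorem theorem2 (R : realType) (Y : topologicalLmodType R) (F : set Y)
    (a : Y) (H : set Y) (k : Y)
    (H_proper : proper_subset H) (H_closed : closed H)
    (k_rec : recession_cone H k) (k_neq0 : k <> 0)
    (slice_compact : exists t1 : R,
       F `&` shift_along (reflect_at a H) k t1 !=set0 /\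
       compact (F `&` shift_along (reflect_at a H) k t1)) :
  ((exists t : R, F `&` shift_along (reflect_at a H) k t = set0) ->
     optimal_solutions F a H k !=set0 /\ compact (optimal_solutions F a H k))
  /\
  ((exists t : R, F `&` shift_along (reflect_at a H) k t = set0) <->
     finite_valued_on (phi (reflect_at a H) k)
       (F `&` dom (phi (reflect_at a H) k))).
Proof.
have [t1 [K0 K_compact]] := slice_compact.
split=> [no_slice|].
  have [m [m_le M0 ->]] := optimal_solutions_slice H_closed k_rec K0 K_compact
    no_slice.
  split=> //.
  (* As [m <= t1], the solution set is the compact slice at [t1] cut by the closed set at [m]; [F]
     itself need not be closed. *)
  rewrite -(setIidr (slice_mono k_rec m_le)) setIA.
  by apply: compact_closedI => //; exact: slice_closed.
split=> [[t0 S0] y [Fy y_dom]|phi_fin].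
  (* Only the value [-oo] remains to be excluded, and [t0] is a real lower bound of [phi] at [y]. *)
  rewrite fin_numElt y_dom andbT (lt_le_trans (ltNyr t0)) //.
  apply: le_ereal_inf_tmp => _ [t Sy <-]; rewrite lee_fin.
  exact: slice_lower_bound S0 Fy Sy.
apply: contrapT => /forallNP S0.
have [y [[Fy _] Sy]] := slice_bigcap_nonempty H_closed k_rec K_compact K0
  (ex_intro setT t1 I) (fun t _ => (set0P _).1 (introN eqP (S0 t))).
have phi_y := phi_ninfty (fun t => Sy t I).
have : phi (reflect_at a H) k y \is a fin_num.
  (* Since [-oo] is below [+oo], the common point [y] belongs to [dom], so the finiteness hypothesis
     applies to it. *)
  by apply: phi_fin; split=> //; rewrite /dom /= phi_y.
by rewrite phi_y.
Qed.
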